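(* Let $n\ge2$, $\gamma>0$, let $K(\mathbf{z}_1,\mathbf{z}_2)=\exp(-\gamma\|\mathbf{z}_1-\mathbf{z}_2\|^2)$ be the Gaussian kernel on $\mathbb{B}^n$, let $R_1,R_2\in SO(n)$ be orientations with relative angle $R=R_2R_1^\top$, and let $\mathbf{x}_1,\mathbf{x}_2\in\mathbb{B}^{n-1}$. With $r=e_n^\top Re_n$, $\mathbf{r}$, $\tilde R$, $\tilde{\mathbf{x}}_{1\mathbf{r}}$, $x_{1\mathbf{r}}$, $\tilde{\mathbf{x}}_{2R}$, $x_{2R}$, $\mu_1^R=r\,x_{1\mathbf{r}}-x_{2R}$ and $\mu_2^R=x_{1\mathbf{r}}-r\,x_{2R}$ as defined in the context from $R,\mathbf{x}_1,\mathbf{x}_2$: 1) If $R_1\sim R_2$ (i.e. $|r|=1$), then $$(\mathcal{P}_{R_1}\circ\mathcal{P}_{R_2}^*\tilde k_{\mathbf{x}_2})(\mathbf{x}_1)=\frac{\exp(-\gamma\|[\tilde{\mathbf{x}}_{1\mathbf{r}}:r\,x_{1\mathbf{r}}]-\tilde R^\top\mathbf{x}_2\|^2)}{2\gamma}\sum_{i,j\in\{0,1\}}(-1)^{i+j}\Phi\big[\sqrt\gamma\,((-1)^iW(\mathbf{x}_1)+(-1)^jW(\mathbf{x}_2))\big].$$ 2) If $R_1\nsim R_2$ (i.e. $|r|<1$), then $$(\mathcal{P}_{R_1}\circ\mathcal{P}_{R_2}^*\tilde k_{\mathbf{x}_2})(\mathbf{x}_1)=\frac{\pi\exp(-\gamma\|\tilde{\mathbf{x}}_{1\mathbf{r}}-\tilde{\mathbf{x}}_{2R}\|^2)}{\gamma\,w(r)}\sum_{i,j\in\{0,1\}}(-1)^{i+j}\Phi_2^r\Big[\sqrt{2\gamma}\,((-1)^iw(r)W(\mathbf{x}_1)-\mu_1^R),\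 \sqrt{2\gamma}\,((-1)^jw(r)W(\mathbf{x}_2)-\mu_2^R)\Big],$$ where $\Phi_2^\rho(a,b)=\mathbb{P}(Z_1\le a,Z_2\le b)$ is the CDF of the standardized bivariate normal distribution $(Z_1,Z_2)$ with correlation $\rho\in(-1,1)$.
   Context: $\mathbb{B}^m$ is the closed unit ball and $\mathbb{S}^{m-1}$ the unit sphere of $\mathbb{R}^m$; $e_k$ is the $k$-th canonical basis vector; $[\cdot:\cdot]$ denotes concatenation (the last entry being a scalar); $w(s)=\sqrt{1-s^2}$; $W(\mathbf{x})=\sqrt{1-\|\mathbf{x}\|^2}$; $I_{\|\mathbf{x}\|}=[-W(\mathbf{x}),W(\mathbf{x})]$. $\mathrm{erf}(z)=\frac{2}{\sqrt\pi}\int_0^ze^{-t^2}dt$ and $\Phi(z)=\sqrt\pi\int_0^z\mathrm{erf}(t)\,dt=\sqrt\pi\,z\,\mathrm{erf}(z)+e^{-z^2}-1$. X-ray transform: $\mathcal{P}_Qf(\mathbf{x})=\int_{I_{\|\mathbf{x}\|}}f(Q^\top[\mathbf{x}:z])\,dz$ for $Q\in SO(n)$. Induced kernel: $\tilde K(\mathbf{x}_1,\mathbf{x}_2)=\int_{I_{\|\mathbf{x}_2\|}}\int_{I_{\|\mathbf{x}_1\|}}K(Q^\top[\mathbf{x}_1:z_1],Q^\top[\mathbf{x}_2:z_2])\,dz_1dz_2$, which does not depend on $Q$ since $K$ is rotation-invariant; $\tilde k_{\mathbf{x}}=\tilde K(\cdot,\mathbf{x})$. $\mathcal{P}_Q^*$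 is the adjoint of the bounded operator $\mathcal{P}_Q:\mathbb{H}(K)\to\mathbb{H}(\tilde K)$ between the RKHSs, and $\mathcal{P}_Q^*(\tilde k_{\mathbf{x}})(\mathbf{z})=\int_{I_{\|\mathbf{x}\|}}K(\mathbf{z},Q^\top[\mathbf{x}:z])\,dz$. $R_1\sim R_2$ means $R_1^\top e_n=\pm R_2^\top e_n$. Euler matrices: for $l=1,\dots,n-1$, $R^l_\phi\in SO(n)$ is the identity except on coordinates $l,l+1$, where it is $\begin{pmatrix}\cos\phi&\sin\phi\\-\sin\phi&\cos\phi\end{pmatrix}$. If $\theta\in\mathbb{S}^{n-1}$ has spherical coordinates $\phi_1\in[-\pi,\pi)$, $\phi_2,\dots,\phi_{n-1}\in[0,\pi]$, i.e. $\theta=(\sin\phi_{n-1}\cdots\sin\phi_2\sin\phi_1,\ \sin\phi_{n-1}\cdots\sin\phi_2\cos\phi_1,\ \sin\phi_{n-1}\cdots\sin\phi_3\cos\phi_2,\dots,\sin\phi_{n-1}\cos\phi_{n-2},\cos\phi_{n-1})^\top$, then $E(\theta)=R^{n-1}_{-\phi_{n-1}}\cdots R^1_{-\phi_1}\in SO(n)$; it satisfies $E(\theta)^\top e_n=\theta$. The point $\tilde\theta\in\mathbb{S}^{n-2}$ with coordinates $\phi_1,\dots,\phi_{n-2}$ satisfies $\theta=[\sin\phi_{n-1}\tilde\theta:\cos\phi_{n-1}]$, with Euler matrix $E(\tilde\theta)\in SO(n-1)$ (equal to $1$ when $n=2$); where spherical coordinates are not unique, one choice is made and used consistently in $E(\theta)$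 and $E(\tilde\theta)$. For $R\in SO(n)$: $\mathbf{r}=R^\top e_n$, $\tilde R\in SO(n-1)$ is the unique rotation with $R=\begin{pmatrix}\tilde R&0\\0&1\end{pmatrix}E(\mathbf{r})$, $\tilde{\mathbf{r}}\in\mathbb{S}^{n-2}$ is obtained from $\mathbf{r}$ as $\tilde\theta$ from $\theta$, and $r=e_n^\top Re_n$. Then $[\tilde{\mathbf{x}}_{2R}:x_{2R}]:=\tilde R^\top\mathbf{x}_2$ and $[\tilde{\mathbf{x}}_{1\mathbf{r}}:x_{1\mathbf{r}}]:=E(\tilde{\mathbf{r}})\mathbf{x}_1$, with $\tilde{\mathbf{x}}_{2R},\tilde{\mathbf{x}}_{1\mathbf{r}}\in\mathbb{B}^{n-2}$ and $x_{2R},x_{1\mathbf{r}}\in[-1,1]$ (for $n=2$ the $\mathbb{B}^{0}$ components are empty). *)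

(* Defs.v *)
From HB Require Import structures.
From mathcomp Require Import all_boot all_order all_algebra.
From mathcomp Require Import all_classical all_reals all_analysis.
Import Order.TTheory GRing.Theory Num.Theory.
Import numFieldNormedType.Exports.

Set Implicit Arguments.
Unset Strict Implicit.
Unset Printing Implicit Defensive.

Local Open Scope classical_set_scope.
Local Open Scope ring_scope.

Section ReproducingKernelHilbertSpace.
Variable R : realType.

(* The Hilbert space of functions on T with reproducing kernel K. A vector is a
   function on T lying in [rkhs_set]; [rkhs_ip] is meaningful only there. By
   the Moore-Aronszajn uniqueness theorem all inhabitants of [rkhs K] have the
   same vectors and the same inner product on them. *)
Record rkhs (T : Type) (K : T -> T -> R) := Rkhs {
  rkhs_set : set (T -> R);
  rkhs_ip : (T -> R) -> (T -> R) -> R;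
  rkhs_0 : rkhs_set (cst 0);
  rkhs_lin : forall a f g,
    rkhs_set f -> rkhs_set g -> rkhs_set (a \*o f \+ g);
  rkhs_ip_sym : forall f g,
    rkhs_set f -> rkhs_set g -> rkhs_ip f g = rkhs_ip g f;
  rkhs_ip_lin : forall a f g h, rkhs_set f -> rkhs_set g -> rkhs_set h ->
    rkhs_ip (a \*o f \+ g) h = a * rkhs_ip f h + rkhs_ip g h;
  rkhs_ip_ge0 : forall f, rkhs_set f -> 0 <= rkhs_ip f f;
  rkhs_ip_eq0 : forall f, rkhs_set f -> rkhs_ip f f = 0 -> f = cst 0;
  rkhs_complete : forall u : nat -> T -> R,
    (forall i, rkhs_set (u i)) ->
    (forall e, 0 < e -> exists N, forall i j, (N <= i)%N -> (N <= j)%N ->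
       Num.sqrt (rkhs_ip (u i \- u j) (u i \- u j)) < e) ->
    exists2 f, rkhs_set f &
      (fun i => Num.sqrt (rkhs_ip (u i \- f) (u i \- f))) @ \oo --> (0 : R);
  rkhs_kernel : forall x, rkhs_set (K ^~ x);
  rkhs_reproducing : forall f x, rkhs_set f -> rkhs_ip f (K ^~ x) = f x
}.

Definition rkhs_norm (T : Type) (K : T -> T -> R) (H : rkhs K) (f : T -> R) : R :=
  Num.sqrt (rkhs_ip H f f).

Record bounded_operator (T1 T2 : Type) (K1 : T1 -> T1 -> R) (K2 : T2 -> T2 -> R)
    (H1 : rkhs K1) (H2 : rkhs K2) (A : (T1 -> R) -> (T2 -> R)) : Prop := {
  bounded_operator_maps : forall f, rkhs_set H1 f -> rkhs_set H2 (A f);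
  bounded_operator_linear : forall a f g,
    rkhs_set H1 f -> rkhs_set H1 g ->
    A (a \*o f \+ g) = a \*o A f \+ A g;
  bounded_operator_bound : exists C : R,
    forall f, rkhs_set H1 f -> rkhs_norm H2 (A f) <= C * rkhs_norm H1 f
}.

Record is_adjoint (T1 T2 : Type) (K1 : T1 -> T1 -> R) (K2 : T2 -> T2 -> R)
    (H1 : rkhs K1) (H2 : rkhs K2) (A : (T1 -> R) -> (T2 -> R))
    (B : (T2 -> R) -> (T1 -> R)) : Prop := {
  is_adjoint_maps : forall g, rkhs_set H2 g -> rkhs_set H1 (B g);
  is_adjointE : forall f g, rkhs_set H1 f -> rkhs_set H2 g ->
    rkhs_ip H2 (A f) g = rkhs_ip H1 f (B g)
}.

End ReproducingKernelHilbertSpace.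

Section EuclideanGeometry.
Variable R : realType.

(* The Euclidean norm; the canonical norm on matrices is the sup norm. *)
Definition enorm m (x : 'cV[R]_m) : R := Num.sqrt (\sum_(i < m) x i 0 ^+ 2).

Definition unit_ball m := {x : 'cV[R]_m | enorm x <= 1}.

(* A function on the unit ball, extended by zero. *)
Definition eval_ball m (f : unit_ball m -> R) (y : 'cV[R]_m) : R :=
  if insub y is Some u then f u else 0.

Definition e_last m : 'cV[R]_m.+1 := delta_mx ord_max 0.

(* [x : z] *)
Definition concat m (x : 'cV[R]_m) (z : R) : 'cV[R]_m.+1 :=
  \col_i (if unlift ord_max i is Some j then x j 0 else z).

(* x = [head_part x : last_coord x] *)
Definition head_part m (x : 'cV[R]_m.+1) : 'cV[R]_m := row' ord_max x.
Definition last_coord m (x : 'cV[R]_m.+1) : R := x ord_max 0.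

Definition SO m : set 'M[R]_m := [set Q | Q^T *m Q = 1%:M /\ \det Q = 1].

(* The block diagonal matrix with blocks Q and 1. *)
Definition extend_rot m (Q : 'M[R]_m) : 'M[R]_m.+1 :=
  \matrix_(i, j) match unlift ord_max i, unlift ord_max j with
                 | Some i', Some j' => Q i' j'
                 | None, None => 1
                 | _, _ => 0
                 end.

Definition same_axis m (R1 R2 : 'M[R]_m.+1) : Prop :=
  R1^T *m e_last m = R2^T *m e_last m \/ R1^T *m e_last m = - (R2^T *m e_last m).

(* The rotation R^l_phi, 1 <= l < m: the 1-based coordinates l and l+1 are the
   0-based indices l-1 and l. *)
Definition plane_rot m (l : nat) (phi : R) : 'M[R]_m :=
  \matrix_(i, j)
    if i.+1 == l then
      (if j.+1 == l then cos phi else if (j : nat) == l then sin phi else 0)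
    else if (i : nat) == l then
      (if j.+1 == l then - sin phi else if (j : nat) == l then cos phi else 0)
    else (i == j)%:R.

(* The point of the unit sphere of R^m with spherical coordinates
   phi 1, ..., phi (m-1); no other value of phi is used. *)
Definition sph_point m (phi : nat -> R) : 'cV[R]_m :=
  \col_(i < m) ((if (i : nat) == 0%N then 1 else cos (phi i)) *
                \prod_(i.+1 <= l < m) sin (phi l)).

Definition sph_coords m (theta : 'cV[R]_m) (phi : nat -> R) : Prop :=
  [/\ - pi <= phi 1%N < pi,
      (forall l, (2 <= l < m)%N -> 0 <= phi l <= pi)
    & theta = sph_point m phi].

(* R^(m-1)_(- phi (m-1)) ... R^1_(- phi 1), the Euler matrix of sph_point m phi.
   If theta = sph_point m.+1 phi, the point derived from theta on the sphere of
   R^m is sph_point m phi, with Euler matrix [euler_mx m phi]. *)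
Definition euler_mx m (phi : nat -> R) : 'M[R]_m :=
  \big[mulmx/1%:M]_(l <- rev (iota 1 m.-1)) plane_rot m l (- phi l).

End EuclideanGeometry.

Section XrayTransform.
Variable R : realType.

Definition w_fun (s : R) : R := Num.sqrt (1 - s ^+ 2).

Definition W_fun m (x : 'cV[R]_m) : R := Num.sqrt (1 - enorm x ^+ 2).

(* The interval I_||x||. *)
Definition chord m (x : 'cV[R]_m) : set R := `[- W_fun x, W_fun x].

Definition Xray m (Q : 'M[R]_m.+1) (f : unit_ball R m.+1 -> R)
    (x : unit_ball R m) : R :=
  \int[lebesgue_measure]_(z in chord (\val x))
    eval_ball f (Q^T *m concat (\val x) z).

Definition induced_kernel m (Q : 'M[R]_m.+1)
    (K : unit_ball R m.+1 -> unit_ball R m.+1 -> R)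
    (x1 x2 : unit_ball R m) : R :=
  \int[lebesgue_measure]_(z2 in chord (\val x2))
    \int[lebesgue_measure]_(z1 in chord (\val x1))
      eval_ball (fun u1 => eval_ball (fun u2 => K u1 u2)
                             (Q^T *m concat (\val x2) z2))
                (Q^T *m concat (\val x1) z1).

Definition gaussian_kernel m (gamma : R) (u v : unit_ball R m) : R :=
  expR (- gamma * enorm (\val u - \val v) ^+ 2).

End XrayTransform.

Section SpecialFunctions.
Variable R : realType.

(* The oriented integral of f from 0 to z. *)
Definition integral0 (f : R -> R) (z : R) : R :=
  if 0 <= z then \int[lebesgue_measure]_(t in `[0, z]) f t
  else - \int[lebesgue_measure]_(t in `[z, 0]) f t.

Definition erf (z : R) : R :=
  2 / Num.sqrt pi * integral0 (fun t => expR (- t ^+ 2)) z.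

Definition Phi (z : R) : R := Num.sqrt pi * integral0 erf z.

Definition binormal_pdf (rho : R) (p : R * R) : R :=
  (2 * pi * Num.sqrt (1 - rho ^+ 2))^-1 *
  expR (- (p.1 ^+ 2 - 2 * rho * p.1 * p.2 + p.2 ^+ 2) / (2 * (1 - rho ^+ 2))).

(* The law of the standardized bivariate normal pair with correlation rho,
   |rho| < 1. *)
Definition binormal_prob (rho : R) (A : set (R * R)) : \bar R :=
  (\int[(@lebesgue_measure R \x @lebesgue_measure R)%E]_(p in A)
    (binormal_pdf rho p)%:E)%E.

Definition Phi2 (rho a b : R) : R :=
  fine (binormal_prob rho [set p | p.1 <= a /\ p.2 <= b]).

End SpecialFunctions.

(* Main.v *)
Require Import Defs.
From mathcomp Require Import all_boot all_order all_algebra.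
From mathcomp Require Import all_classical all_reals all_analysis.
From mathcomp Require Import measurable_realfun ring lra zify.
Import Order.TTheory GRing.Theory Num.Theory.
Import numFieldNormedType.Exports.
Local Open Scope ring_scope.

(** By the reproducing property, the adjoint sends the kernel section at [x2] to
    the X-ray transform at [x2] of Gaussian kernel sections ([adjoint_kernel]), so
    the left-hand side is the integral of [exp (- gamma |A - B|^2)], where
    [A = R1^T [x1 : z1]] and [B = R2^T [x2 : z2]] run over two chords of the ball
    ([Xray_adjoint_gaussian]).

    The Euler matrix of the relative angle is a rotation of the last two
    coordinates applied after the Euler matrix of one dimension less. In adapted
    coordinates the squared distance is therefore a constant plus a quadratic
    polynomial in the two chord parameters which depends only on the cosine [r]
    and the sine [s] of the last spherical coordinate ([chord_points_distance]);
    the constant factors out of the integral.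

    If [s = 0], the chords are parallel and the integrand depends only on
    [z1 - z2] or [z1 + z2]: two successive primitives of the Gaussian give [Phi] at
    four points ([chords_integral_parallel]). If [s] is not zero, completing the
    square shows that the integrand is, in affinely rescaled parameters, a
    multiple of the binormal density of correlation [r] over a rectangle
    ([chords_integral_transverse]), whose probability is the signed sum of the
    values of [Phi2] at its corners ([Phi2_rect]). *)

Set Implicit Arguments.
Unset Strict Implicit.
Unset Printing Implicit Defensive.

(* The unqualified name also stands for the lemma that the integral of zero vanishes. *)
Local Notation integral0 := Defs.integral0.

(** * Oriented integrals and affine substitutions *)
Section primitives.
Local Open Scope classical_set_scope.
Local Open Scope ring_scope.
Variable R : realType.
Notation mu := (@lebesgue_measure R).
Implicit Types (f F : R -> R) (a b : R).

Lemma continuous_integrable f a b : continuous f ->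
  mu.-integrable `[a, b] (EFin \o f).
Proof.
move=> cf; apply: continuous_compact_integrable; first exact: segment_compact.
exact: continuous_subspaceT.
Qed.

Lemma is_derive_continuous f (df : R -> R) :
  (forall x, is_derive x (1:R) f (df x)) -> continuous f.
Proof.
by move=> h x; apply: differentiable_continuous; apply/derivable1_diffP; case: (h x).
Qed.

Lemma Rintegral_FTC2 f F a b : a <= b -> continuous f ->
  (forall x, is_derive x (1:R) F (f x)) ->
  \int[mu]_(x in `[a, b]) f x = F b - F a.
Proof.
rewrite le_eqVlt => /predU1P[<- _ _|ab cf dF].
  by rewrite set_itv1 Rintegral_set1 subrr.
have cF := is_derive_continuous dF.
rewrite /Rintegral (@continuous_FTC2 _ f F)//.
- exact: continuous_subspaceT.
- split.
  + by move=> x _; case: (dF x).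
  + by apply: cvg_at_right_filter; exact: cF.
  + by apply: cvg_at_left_filter; exact: cF.
- by move=> x _; rewrite derive1E; case: (dF x).
Qed.

(** Moving the base point to any [c] below [0] and [x] rewrites both branches
    of the oriented integral as one formula, to which the fundamental theorem
    on an interval with fixed left end applies. *)
Lemma integral0B f c x : continuous f -> c <= 0 -> c <= x ->
  integral0 f x = \int[mu]_(t in `[c, x]) f t - \int[mu]_(t in `[c, 0]) f t.
Proof.
move=> cf c0 cx; rewrite /integral0; case: ifPn => [x0|].
  rewrite (@Rintegral_itvB _ f (BLeft c) (BRight x) 0) ?bnd_simp//; last first.
    exact: continuous_integrable.
  rewrite Rintegral_itv_obnd_cbnd//.
  apply: (integrableS _ _ _ (continuous_integrable 0 x cf)) => //.
    by apply: subset_itvr; rewrite bnd_simp.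
rewrite -ltNge => /ltW x0.
rewrite -opprB; congr (- _).
rewrite (@Rintegral_itvB _ f (BLeft c) (BRight 0) x) ?bnd_simp//; last first.
  exact: continuous_integrable.
rewrite Rintegral_itv_obnd_cbnd//.
apply: (integrableS _ _ _ (continuous_integrable x 0 cf)) => //.
  by apply: subset_itvr; rewrite bnd_simp.
Qed.

(** With a base point [c] at distance 1 below [0] and [x], the oriented integral
    is near [x] a constant away from the integral over [[c, y]]. *)
Lemma is_derive_integral0 f x : continuous f -> is_derive x (1:R) (integral0 f) (f x).
Proof.
move=> cf; pose c := - `|x| - 1.
have c0 : c <= 0 by rewrite /c; have := normr_ge0 x; lra.
have cx : c < x by rewrite /c; have := ler_norm (- x); rewrite normrN; lra.
have xx1 : x < x + 1 by lra.
have [d1 d2] : derivable (fun y => \int[mu]_(t in `[c, y]) f t) x 1 /\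
    (fun y => \int[mu]_(t in `[c, y]) f t)^`()%classic x = f x.
  by apply: (@continuous_FTC1_closed _ f c x (x + 1)) => //;
    [exact: continuous_integrable|exact: cf].
have d : is_derive x (1:R) ((fun y => \int[mu]_(t in `[c, y]) f t) \-
    cst (\int[mu]_(t in `[c, 0]) f t)) (f x).
  rewrite -[f x]subr0; apply: is_deriveB; apply: DeriveDef => //.
  by rewrite -derive1E.
apply: (@near_eq_is_derive _ _ _ _ _ _ _ _ _ d).
near=> y; rewrite (@integral0B f c)//=.
by apply/ltW; near: y; apply: lt_nbhsr.
Unshelve. all: by end_near. Qed.

Lemma continuous_integral0 f : continuous f -> continuous (integral0 f).
Proof.
by move=> cf; apply: is_derive_continuous => x; exact: is_derive_integral0.
Qed.

(** Because the oriented integral is a primitive on the whole line, the same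
    formula covers increasing and decreasing substitutions. *)
Lemma Rintegral_affine f a b k m : a <= b -> k != 0 -> continuous f ->
  \int[mu]_(x in `[a, b]) f (k * x + m) =
  (integral0 f (k * b + m) - integral0 f (k * a + m)) / k.
Proof.
move=> ab k0 cf.
have dA (x : R) : is_derive x (1:R) (fun x => k * x + m) k.
  have := is_deriveD (is_deriveZ k (is_derive_id x (1:R)))
    (is_derive_cst m x (1:R)).
  by rewrite /= addr0 scaler1.
have cA := is_derive_continuous dA.
have dF (x : R) : is_derive x (1:R) (fun x => k^-1 * integral0 f (k * x + m))
    (f (k * x + m)).
  have := is_deriveZ k^-1 (@is_derive1_comp _ (integral0 f) (fun x => k * x + m)
    x _ _ (is_derive_integral0 (k * x + m) cf) (dA x)).
  rewrite [X in is_derive _ _ _ X](_ : _ = f (k * x + m))//.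
  by rewrite /GRing.scale/= mulrCA mulVf ?mulr1.
rewrite (Rintegral_FTC2 ab _ dF); first by rewrite -mulrBr mulrC.
by move=> x; apply: continuous_comp; [exact: cA|exact: cf].
Qed.
End primitives.

(** * One integration of the Gaussian over a strip *)
Section gaussian_primitives.
Local Open Scope classical_set_scope.
Local Open Scope ring_scope.
Variable R : realType.
Notation mu := (@lebesgue_measure R).

Definition gauss_prim : R -> R := integral0 gauss_fun.

Lemma continuous_gauss_prim : continuous gauss_prim.
Proof. by apply: continuous_integral0; exact: continuous_gauss_fun. Qed.

Lemma integral0Zl (f : R -> R) k z : continuous f ->
  integral0 (fun t => k * f t) z = k * integral0 f z.
Proof.
move=> cf; rewrite /Defs.integral0.
by case: ifP => _; rewrite RintegralZl ?mulrN//; exact: continuous_integrable.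
Qed.

(** The normalizing constants of the error function and of [Phi] cancel up to
    the factor 2, so [Phi] is a second primitive of the Gaussian. *)
Lemma PhiE (z : R) : Phi z = 2 * integral0 gauss_prim z.
Proof.
rewrite /Phi integral0Zl; last exact: continuous_gauss_prim.
by rewrite mulrA mulrCA mulfV ?mulr1// gt_eqF// sqrtr_gt0 pi_gt0.
Qed.

(** The value, up to a constant, of the inner integral of a product of two
    Gaussians of affine forms. Both integrals over pairs of chords and
    rectangle probabilities of the binormal law reduce to integrals of such
    functions, which are stable under affine substitution. *)
Definition gauss_slab (k0 m0 k m1 m2 x : R) : R :=
  gauss_fun (k0 * x + m0) * (gauss_prim (k * x + m1) - gauss_prim (k * x + m2)).

Lemma continuous_affine (k m : R) : continuous (fun x : R => k * x + m).
Proof.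
by move=> x; apply: cvgD; [apply: cvgMr; exact: cvg_id|exact: cvg_cst].
Qed.

Lemma continuous_comp_affine (f : R -> R) (k m : R) :
  continuous f -> continuous (fun x => f (k * x + m)).
Proof.
move=> cf x; apply: (@continuous_comp _ _ _ (fun x => k * x + m) f); last exact: cf.
exact: continuous_affine.
Qed.

Lemma continuous_gauss_slab k0 m0 k m1 m2 :
  continuous (gauss_slab k0 m0 k m1 m2).
Proof.
move=> x; apply: cvgM; last apply: cvgB.
- by apply: continuous_comp_affine; exact: continuous_gauss_fun.
- by apply: continuous_comp_affine; exact: continuous_gauss_prim.
- by apply: continuous_comp_affine; exact: continuous_gauss_prim.
Qed.

Lemma Rintegral_gauss_slab (k0 m0 k m l a b x : R) : a <= b -> l != 0 ->
  \int[mu]_(y in `[a, b]) (gauss_fun (k0 * x + m0) * gauss_fun (l * y + (k * x + m)))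
  = l^-1 * gauss_slab k0 m0 k (l * b + m) (l * a + m) x.
Proof.
move=> ab l0; have cg := @continuous_gauss_fun R.
rewrite RintegralZl//; last first.
  by apply: continuous_integrable; exact: continuous_comp_affine.
rewrite Rintegral_affine// -/gauss_prim /gauss_slab.
by rewrite !(addrCA (l * _)) mulrA mulrC.
Qed.

(** When the first Gaussian factor is constant, what remains is the primitive of
    the Gaussian along an affine form of slope [- sqrt g] or [sqrt g]; a second
    primitive is [Phi / 2], and its values at the four ends give the signed sum.
    The two slopes permute these four values. *)
Lemma Rintegral_parallel (g c m0 W1 W2 : R) : 0 < g -> c = 1 \/ c = -1 ->
  0 <= W1 ->
  \int[mu]_(x in `[- W1, W1]) gauss_slab 0 m0 (- (Num.sqrt g * c))
      (Num.sqrt g * W2) (- (Num.sqrt g * W2)) x =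
  gauss_fun m0 / (2 * Num.sqrt g) *
     \sum_(i < 2) \sum_(j < 2) (-1) ^+ (i + j) *
        Phi (Num.sqrt g * ((-1) ^+ i * W1 + (-1) ^+ j * W2)).
Proof.
move=> g0 hc W10; have gg := g0; rewrite -sqrtr_gt0 in gg.
have NW : - W1 <= W1 by lra.
have k0 : - (Num.sqrt g * c) != 0.
  by case: hc => ->; rewrite ?mulr1 ?mulrN1 ?opprK ?oppr_eq0 gt_eqF.
have cG := continuous_gauss_prim.
have cA m : continuous (fun x => gauss_prim (- (Num.sqrt g * c) * x + m)).
  exact: continuous_comp_affine.
rewrite /gauss_slab; under eq_Rintegral do rewrite mul0r add0r.
rewrite RintegralZl//; last first.
  by apply: continuous_integrable => x; apply: cvgB; exact: cA.
rewrite RintegralB//; [|exact: continuous_integrable..].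
rewrite !Rintegral_affine// !big_ord_recl !big_ord0 /= !PhiE /bump /=.
rewrite !expr0 !expr1 !expr2 !addr0 !mul1r.
set P := integral0 gauss_prim.
rewrite -mulrA; congr (_ * _).
set q := Num.sqrt g in gg *.
have q0 : q != 0 by rewrite gt_eqF.
have eqP4 u v : u = v -> P u = P v by move=> ->.
case: hc => ->.
- rewrite (eqP4 (- (q * 1) * W1 + q * W2) (q * (-1 * W1 + W2))); last by ring.
  rewrite (eqP4 (- (q * 1) * - W1 + q * W2) (q * (W1 + W2))); last by ring.
  rewrite (eqP4 (- (q * 1) * W1 - q * W2) (q * (-1 * W1 + -1 * W2))); last by ring.
  rewrite (eqP4 (- (q * 1) * - W1 - q * W2) (q * (W1 + -1 * W2))); last by ring.
  by field.
- rewrite (eqP4 (- (q * -1) * W1 + q * W2) (q * (W1 + W2))); last by ring.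
  rewrite (eqP4 (- (q * -1) * - W1 + q * W2) (q * (-1 * W1 + W2))); last by ring.
  rewrite (eqP4 (- (q * -1) * W1 - q * W2) (q * (W1 + -1 * W2))); last by ring.
  rewrite (eqP4 (- (q * -1) * - W1 - q * W2) (q * (-1 * W1 + -1 * W2))); last by ring.
  by field.
Qed.
End gaussian_primitives.

(** * The binormal density and its rectangle probabilities *)
Section binormal.
Local Open Scope classical_set_scope.
Local Open Scope ring_scope.
Variable R : realType.
Notation mu := (@lebesgue_measure R).
Variable rho : R.
Hypothesis rho1 : `|rho| < 1.
Let s := Num.sqrt (1 - rho ^+ 2).

Lemma corr_sd_gt0 : 0 < s.
Proof.
rewrite sqrtr_gt0 subr_gt0 -real_normK ?num_real//.
by rewrite exprn_ilt1.
Qed.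

(** Completing the square in [y] separates the law of the first coordinate from
    the conditional law of the second one. *)
Lemma binormal_pdfE (x y : R) : binormal_pdf rho (x, y) =
  (2 * pi * s)^-1 * (gauss_fun ((Num.sqrt 2)^-1 * x + 0) *
     gauss_fun ((Num.sqrt 2 * s)^-1 * y + (- (rho * (Num.sqrt 2 * s)^-1) * x + 0))).
Proof.
have s0 := corr_sd_gt0; have s0' : s != 0 by rewrite gt_eqF.
have q2 : Num.sqrt 2 ^+ 2 = 2 :> R by rewrite sqr_sqrtr.
have q20 : Num.sqrt 2 != 0 :> R by rewrite sqrtr_eq0 -ltNge.
have s2 : 1 - rho ^+ 2 = s ^+ 2.
  by rewrite sqr_sqrtr// ltW// -sqrtr_gt0.
rewrite /binormal_pdf /gauss_fun /= -expRD -/s; congr (_ * expR _).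
rewrite s2 -[X in X * s ^+ 2]q2.
have -> : x ^+ 2 - 2 * rho * x * y + y ^+ 2 = (y - rho * x) ^+ 2 + s ^+ 2 * x ^+ 2.
  by rewrite -s2; ring.
by field; rewrite s0' q20.
Qed.

Lemma measurable_binormal_pdf : measurable_fun [set: R * R] (binormal_pdf rho).
Proof.
rewrite /binormal_pdf.
apply: measurable_funM => //; apply: measurableT_comp => //.
apply: measurable_funM => //; apply: measurableT_comp => //.
apply: measurable_funD; last by apply: measurable_funX.
apply: measurable_funB; first by apply: measurable_funX.
apply: measurable_funM => //.
by apply: measurable_funM => //.
Qed.

Lemma binormal_pdf_ge0 p : 0 <= binormal_pdf rho p.
Proof.
rewrite mulr_ge0 ?expR_ge0// invr_ge0 !mulr_ge0 ?pi_ge0//.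
Qed.

(** As [x^2 - 2 rho x y + y^2 >= (1 - |rho|) (x^2 + y^2)] and [1 + |rho| <= 2],
    the density is dominated, uniformly in [rho] up to the constant, by a product
    of two centred normal functions of variance 2. *)
Lemma binormal_pdf_le (x y : R) : binormal_pdf rho (x, y) <=
  (2 * pi * s)^-1 * (normal_fun 0 (Num.sqrt 2) x * normal_fun 0 (Num.sqrt 2) y).
Proof.
have s0 := corr_sd_gt0.
rewrite ler_pM2l ?invr_gt0 ?mulr_gt0 ?pi_gt0//.
rewrite /normal_fun -expRD ler_expR /= !subr0 sqr_sqrtr//.
have s2 : 0 < 1 - rho ^+ 2 by rewrite -sqrtr_gt0.
rewrite !mulNr -opprD lerN2 -mulrDl.
rewrite ler_pdivlMr ?mulr_gt0// mulrAC ler_pdivrMr//.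
have : (2%R *+ 2 = 4 :> R) by rewrite -mulr_natr; ring.
move=> ->; rewrite -subr_ge0.
have := rho1; rewrite ltr_norml => /andP[r1 r2].
rewrite (_ : _ - _ = (1 + rho ^+ 2) * (x ^+ 2 + y ^+ 2) * 2 - 8 * rho * x * y); last by ring.
have := sqr_ge0 (x - rho * y); have := sqr_ge0 (y - rho * x); nra.
Qed.

(** Finiteness is what makes differences of values of [Phi2] meaningful: [Phi2]
    is the finite part of an extended real. *)
Lemma integrable_binormal_pdf :
  (mu \x mu)%E.-integrable setT (EFin \o binormal_pdf rho).
Proof.
have s0 := corr_sd_gt0.
have q2 : Num.sqrt 2 != 0 :> R by rewrite sqrtr_eq0 -ltNge.
have pk := normal_peak_gt0 q2; have pk0 : normal_peak (Num.sqrt 2 : R) != 0 by rewrite gt_eqF.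
pose n := normal_pdf 0 (Num.sqrt 2) : R -> R.
pose k := (2 * pi * s)^-1 / normal_peak (Num.sqrt 2) ^+ 2.
pose h (p : R * R) := k * (n p.1 * n p.2).
have k0 : 0 <= k by rewrite divr_ge0 ?sqr_ge0// invr_ge0 !mulr_ge0 ?pi_ge0// ltW.
have n0 x : 0 <= n x by exact: normal_pdf_ge0.
have mn : measurable_fun setT n by exact: measurable_normal_pdf.
apply: (@le_integrable _ _ _ (mu \x mu)%E _ measurableT (EFin \o binormal_pdf rho) (EFin \o h)).
- apply/measurable_EFinP; exact: measurable_binormal_pdf.
- move=> [x y] _ /=; rewrite lee_fin ger0_norm ?binormal_pdf_ge0// ger0_norm; last first.
    by rewrite /h mulr_ge0 //= mulr_ge0.
  rewrite (le_trans (binormal_pdf_le x y))// /h /k /n /= normal_pdfE//.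
  rewrite le_eqVlt; apply/orP; left; apply/eqP.
  by move: (_^-1) pk0 => c p0; field.
apply: (@integrable12ltyP _ _ _ _ _ mu mu _ _).2.
  apply/measurable_EFinP; apply: measurable_funM => //.
  by apply: measurable_funM; apply: (measurableT_comp mn).
have hE x y : `|h (x, y)| = k * n x * n y.
  by rewrite ger0_norm /h /= ?mulrA// mulr_ge0 //= mulr_ge0.
have nE x : (\int[mu]_y `|(h (x, y))%:E|)%E = (k * n x)%:E.
  under eq_integral => y _.
    rewrite /= hE EFinM.
  over.
  rewrite ge0_integralZl//.
  - by rewrite integral_normal_pdf mule1.
  - exact/measurable_EFinP.
  - by move=> y _; rewrite lee_fin.
  - by rewrite lee_fin mulr_ge0.
rewrite /=; under eq_integral => x _ do rewrite nE EFinM.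
rewrite ge0_integralZl//.
- by rewrite integral_normal_pdf mule1 ltry.
- exact/measurable_EFinP.
- by move=> y _; rewrite lee_fin.
Qed.
End binormal.

(** * Inclusion-exclusion and iterated integrals *)
Section rectangles.
Local Open Scope classical_set_scope.
Local Open Scope ring_scope.
Variable R : realType.
Notation mu := (@lebesgue_measure R).
Notation M := (mu \x mu)%E.

Lemma Rintegral_prod_rect (f : R * R -> R) (a1 b1 a2 b2 : R) :
  measurable_fun setT f -> (forall p, 0 <= f p) ->
  (forall x, continuous (fun y => f (x, y))) ->
  \int[M]_(p in `]a1, b1] `*` `]a2, b2]) f p =
  \int[mu]_(x in `[a1, b1]) \int[mu]_(y in `[a2, b2]) f (x, y).
Proof.
move=> mf f0 cf; rewrite /Rintegral; congr fine.
have mD : measurable (`]a1, b1] `*` `]a2, b2] : set (R * R)) by exact: measurableX.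
have mfD : measurable_fun setT ((EFin \o f) \_ (`]a1, b1] `*` `]a2, b2])).
  apply/(measurable_restrictT _ mD).
  by apply/measurable_EFinP; exact: measurable_funTS.
set h := (_ \_ _) in mfD.
have h0 p : (0 <= h p)%E.
  by rewrite /h patchE; case: ifPn => //=; rewrite lee_fin.
have hE x : x \in [set` `]a1, b1]] ->
    (\int[mu]_(y in `]a2, b2]) (f (x, y))%:E = fubini_F mu h x)%E.
  move=> xD; rewrite integral_mkcond; apply: eq_integral => y _.
  by rewrite /h !patchE in_setX xD.
rewrite integral_mkcond -/h fubini_tonelli1//.
transitivity (\int[mu]_(x in `]a1, b1]) (\int[mu]_(y in `]a2, b2]) (f (x, y))%:E))%E.
  rewrite [RHS]integral_mkcond; apply: eq_integral => x _.
  rewrite patchE; case: ifPn => xD; first by rewrite hE.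
  by apply: integral0_eq => y _; rewrite /h patchE in_setX (negbTE xD).
rewrite integral_itv_obnd_cbnd; last first.
  apply: (@eq_measurable_fun _ _ _ _ _ (fubini_F mu h)).
    by move=> x /hE.
  by apply: measurable_funTS; exact: measurable_fun_fubini_tonelli_F.
apply: eq_integral => x _.
rewrite integral_itv_obnd_cbnd; last first.
  apply/measurable_EFinP/measurable_funTS.
  by apply: continuous_measurable_fun; exact: cf.
by rewrite fineK//; apply: integrable_fin_num => //; apply: continuous_integrable; exact: cf.
Qed.

Variable rho : R.
Hypothesis rho1 : `|rho| < 1.

(** Inclusion-exclusion for the quadrants with vertices at the four corners. *)
Lemma Phi2_rect (a1 b1 a2 b2 : R) : a1 <= b1 -> a2 <= b2 ->
  Phi2 rho b1 b2 - Phi2 rho b1 a2 - Phi2 rho a1 b2 + Phi2 rho a1 a2 =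
  \int[M]_(p in `]a1, b1] `*` `]a2, b2]) (binormal_pdf rho p).
Proof.
move=> ab1 ab2.
pose I (A B : set R) := \int[M]_(p in A `*` B) (binormal_pdf rho p).
have PhiI a b : Phi2 rho a b = I [set` `]-oo, a]] [set` `]-oo, b]].
  by [].
have split (a b : R) : a <= b -> [set` `]-oo, b]] = [set` `]-oo, a]] `|` [set` `]a, b]].
  by move=> ab; rewrite -itv_bndbnd_setU.
have XUl (A B C : set R) : (A `|` B) `*` C = A `*` C `|` B `*` C.
  by apply/seteqP; split => -[x y] /=; tauto.
have XUr (A B C : set R) : C `*` (A `|` B) = C `*` A `|` C `*` B.
  by apply/seteqP; split => -[x y] /=; tauto.
have IU1 (a b : R) B : measurable B -> a <= b ->
    I [set` `]-oo, b]] B = I [set` `]-oo, a]] B + I [set` `]a, b]] B.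
  move=> mB ab; rewrite /I (split _ _ ab) XUl Rintegral_setU//.
  - exact: measurableX.
  - exact: measurableX.
  - apply: integrableS (integrable_binormal_pdf rho1) => //.
    by apply: measurableU; exact: measurableX.
  - apply/disj_setPS => -[x y] /= [[+ _] [+ _]].
    by rewrite !in_itv/= => xa /andP[]; rewrite ltNge xa.
have IU2 (a b : R) A : measurable A -> a <= b ->
    I A [set` `]-oo, b]] = I A [set` `]-oo, a]] + I A [set` `]a, b]].
  move=> mB ab; rewrite /I (split _ _ ab) XUr Rintegral_setU//.
  - exact: measurableX.
  - exact: measurableX.
  - apply: integrableS (integrable_binormal_pdf rho1) => //.
    by apply: measurableU; exact: measurableX.
  - apply/disj_setPS => -[x y] /= [[_ +] [_ +]].
    by rewrite !in_itv/= => xa /andP[]; rewrite ltNge xa.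
rewrite !PhiI -/(I _ _) (IU2 a2 b2)// (IU2 a2 b2)// (IU1 a1 b1 [set` `]a2, b2]])//.
ring.
Qed.
End rectangles.

(** * The Gaussian integrated over a pair of chords *)
Section chords_integral.
Local Open Scope classical_set_scope.
Local Open Scope ring_scope.
Variable R : realType.
Notation mu := (@lebesgue_measure R).

Lemma Rintegral_oppr (f : R -> R) W : 0 <= W -> continuous f ->
  \int[mu]_(z in `[- W, W]) f (- z) = \int[mu]_(z in `[- W, W]) f z.
Proof.
move=> W0 cf; have NW : - W <= W by lra.
transitivity (\int[mu]_(z in `[- W, W]) f (-1 * z + 0)).
  by apply: eq_Rintegral => z _; rewrite mulN1r addr0.
transitivity (\int[mu]_(z in `[- W, W]) f (1 * z + 0)); last first.
  by apply: eq_Rintegral => z _; rewrite mul1r addr0.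
rewrite !Rintegral_affine ?oppr_eq0 ?oner_eq0//.
by rewrite !addr0 !mul1r !mulN1r opprK divr1 invrN invr1 mulrN1 opprB.
Qed.

(** The Gaussian of the part of the displacement between the points of parameters
    [z1] and [z2] of two chords that varies with them: [c] and [s] are the cosine
    and sine of the angle between the chords, [p] and [q] the components of the
    offset. *)
Definition chords_gauss (g p q c s z1 z2 : R) : R :=
  expR (- g * ((p - s * z1) ^+ 2 + (q + c * z1 - z2) ^+ 2)).

Definition chords_integral (g p q c s W1 W2 : R) : R :=
  \int[mu]_(z1 in `[- W1, W1]) \int[mu]_(z2 in `[- W2, W2])
    chords_gauss g p q c s z1 z2.

Variables (g p q c W1 W2 : R).
Hypotheses (g0 : 0 < g) (W10 : 0 <= W1) (W20 : 0 <= W2).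
Let sg0 : 0 < Num.sqrt g. Proof. by rewrite sqrtr_gt0. Qed.
Let sgE : Num.sqrt g ^+ 2 = g. Proof. by rewrite sqr_sqrtr// ltW. Qed.

Lemma chords_integral_inner s z1 : \int[mu]_(z2 in `[- W2, W2])
    chords_gauss g p q c s z1 z2 =
  (Num.sqrt g)^-1 * gauss_slab (Num.sqrt g * s) (- (Num.sqrt g * p))
     (- (Num.sqrt g * c)) (Num.sqrt g * W2 - Num.sqrt g * q)
     (- (Num.sqrt g * W2) - Num.sqrt g * q) z1.
Proof.
have NW2 : - W2 <= W2 by rewrite (le_trans _ W20)// oppr_le0.
rewrite -[in RHS](mulrN _ W2) -Rintegral_gauss_slab ?gt_eqF//.
apply: eq_Rintegral => z2 _; rewrite /chords_gauss /gauss_fun -expRD -[in LHS]sgE; congr expR.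
by ring.
Qed.

Lemma chords_integralE s : chords_integral g p q c s W1 W2 =
  (Num.sqrt g)^-1 * \int[mu]_(z1 in `[- W1, W1])
     gauss_slab (Num.sqrt g * s) (- (Num.sqrt g * p))
     (- (Num.sqrt g * c)) (Num.sqrt g * W2 - Num.sqrt g * q)
     (- (Num.sqrt g * W2) - Num.sqrt g * q) z1.
Proof.
rewrite /chords_integral; under eq_Rintegral do rewrite chords_integral_inner.
rewrite RintegralZl//; apply: continuous_integrable.
exact: continuous_gauss_slab.
Qed.

(** Here [s = 0] makes the first component of the displacement constant. *)
Lemma chords_integral_parallel : c = 1 \/ c = -1 -> q = 0 ->
  chords_integral g p q c 0 W1 W2 = expR (- g * p ^+ 2) / (2 * g) *
     \sum_(i < 2) \sum_(j < 2) (-1) ^+ (i + j) *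
        Phi (Num.sqrt g * ((-1) ^+ i * W1 + (-1) ^+ j * W2)).
Proof.
move=> hc q0; rewrite chords_integralE q0 !mulr0 !subr0 Rintegral_parallel// mulrA.
congr (_ * _); rewrite /gauss_fun sqrrN exprMn sgE mulNr.
by rewrite -[X in _ = _ / (2 * X)]sgE; field; rewrite gt_eqF.
Qed.

End chords_integral.

Section chords_values.
Local Open Scope classical_set_scope.
Local Open Scope ring_scope.
Variable R : realType.
Notation mu := (@lebesgue_measure R).

Lemma continuous_chords_gauss (g p q c s z1 : R) : 0 < g ->
  continuous (chords_gauss g p q c s z1).
Proof.
move=> g0; have -> : chords_gauss g p q c s z1 =
    fun z2 => expR (- g * (p - s * z1) ^+ 2) *
      gauss_fun (- Num.sqrt g * z2 + Num.sqrt g * (q + c * z1)).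
  apply/funext => z2; rewrite /chords_gauss /gauss_fun -expRD; congr expR.
  by move: (Num.sqrt g) (sqr_sqrtr (ltW g0)) => t <-; ring.
move=> z2; apply: cvgMr; apply: continuous_comp_affine.
exact: continuous_gauss_fun.
Qed.

Lemma continuous_chords_integral_inner (g p q c s W : R) : 0 < g -> 0 <= W ->
  continuous (fun z1 => \int[mu]_(z2 in `[- W, W]) chords_gauss g p q c s z1 z2).
Proof.
move=> g0 W0.
rewrite (_ : (fun z1 => _) = fun z1 => (Num.sqrt g)^-1 *
  gauss_slab (Num.sqrt g * s) (- (Num.sqrt g * p)) (- (Num.sqrt g * c))
     (Num.sqrt g * W - Num.sqrt g * q) (- (Num.sqrt g * W) - Num.sqrt g * q) z1).
  by move=> x; apply: cvgMr; exact: continuous_gauss_slab.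
by apply/funext => z1; exact: chords_integral_inner.
Qed.

(** Reversing the parameters of both chords changes the sign of [s] and [q]. In
    the plane the only spherical coordinate ranges over [[- pi, pi[], so that its
    sine may be negative; this symmetry reduces that case to a positive sine. *)
Lemma chords_integral_flip (g p q c s W1 W2 : R) : 0 < g ->
  0 <= W1 -> 0 <= W2 ->
  chords_integral g p (- q) c (- s) W1 W2 = chords_integral g p q c s W1 W2.
Proof.
move=> g0 W10 W20; rewrite /chords_integral.
rewrite -[RHS](Rintegral_oppr W10 (@continuous_chords_integral_inner g p q c s W2 g0 W20)).
apply: eq_Rintegral => z1 _.
rewrite -[RHS](Rintegral_oppr W20 (@continuous_chords_gauss g p q c s (- z1) g0)).
apply: eq_Rintegral => z2 _; rewrite /chords_gauss; congr expR.
ring.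
Qed.

Lemma continuous_binormal_pdf_section (c x : R) : `|c| < 1 ->
  continuous (fun y => binormal_pdf c (x, y)).
Proof.
move=> c1; under eq_fun do rewrite binormal_pdfE//.
move=> y; do 2!apply: cvgMr; apply: continuous_comp_affine.
exact: continuous_gauss_fun.
Qed.

(** With [u1 = s z1 - (c a - b)] and [u2 = s z2 - (a - c b)] one has
    [(c a - b - s z1)^2 + (s a + c z1 - z2)^2
       = (u1^2 - 2 c u1 u2 + u2^2) / s^2],
    so that [sqrt (2 g) (u1, u2)] turns the integrand into a multiple of the
    binormal density of correlation [c], with Jacobian [2 g s^2], and the product
    of the chords into a rectangle. Both sides are compared after their inner
    integration, where they become the same function of [z1]. *)
Lemma chords_integral_transverse (g a b c s W1 W2 : R) :
  0 < g -> 0 <= W1 -> 0 <= W2 -> 0 < s -> `|c| < 1 -> s = Num.sqrt (1 - c ^+ 2) ->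
  chords_integral g (c * a - b) (s * a) c s W1 W2 =
  pi / (g * s) * \sum_(i < 2) \sum_(j < 2) (-1) ^+ (i + j) *
    Phi2 c (Num.sqrt (2 * g) * ((-1) ^+ i * s * W1 - (c * a - b)))
           (Num.sqrt (2 * g) * ((-1) ^+ j * s * W2 - (a - c * b))).
Proof.
move=> g0 W10 W20 s0 c1 sE.
have s2 : s ^+ 2 = 1 - c ^+ 2 by rewrite sE sqr_sqrtr// ltW// -sqrtr_gt0 -sE.
pose p := c * a - b; pose p' := a - c * b.
rewrite !big_ord_recl !big_ord0 /= /bump /= !expr0 !expr1 -/p -/p'.
have g20 : 0 < Num.sqrt (2 * g) by rewrite sqrtr_gt0 mulr_gt0.
have g2E : Num.sqrt (2 * g) = Num.sqrt 2 * Num.sqrt g by rewrite sqrtrM.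
have sg0 : 0 < Num.sqrt g by rewrite sqrtr_gt0.
have st0 : 0 < Num.sqrt 2 :> R by rewrite sqrtr_gt0.
have sgE : Num.sqrt g ^+ 2 = g by rewrite sqr_sqrtr// ltW.
set b1 := _ * (1 * s * W1 - p); set a1 := _ * (-1 * s * W1 - p).
set b2 := _ * (1 * s * W2 - p'); set a2 := _ * (-1 * s * W2 - p').
have ab1 : a1 <= b1.
  by rewrite /a1 /b1 ler_pM2l// lerD2r; have := mulr_ge0 (ltW s0) W10; lra.
have ab2 : a2 <= b2.
  by rewrite /a2 /b2 ler_pM2l// lerD2r; have := mulr_ge0 (ltW s0) W20; lra.
have := Phi2_rect c1 ab1 ab2.
rewrite Rintegral_prod_rect//; first last.
- by move=> x; exact: continuous_binormal_pdf_section.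
- by move=> z; exact: binormal_pdf_ge0.
- exact: measurable_binormal_pdf.
pose l := (Num.sqrt 2 * s)^-1.
pose H := gauss_slab (Num.sqrt 2)^-1 0 (- (c * l)) (l * b2 + 0) (l * a2 + 0).
have l0 : l != 0 by rewrite invr_eq0 mulf_neq0 ?gt_eqF.
have cH : continuous H by exact: continuous_gauss_slab.
have inner x : \int[mu]_(y in `[a2, b2]) binormal_pdf c (x, y) =
   ((2 * pi * s)^-1 * l^-1) * H x.
  under eq_Rintegral do rewrite binormal_pdfE// -sE -/l.
  rewrite RintegralZl//; last first.
    apply: continuous_integrable => y; apply: cvgMr.
    by apply: continuous_comp_affine; exact: continuous_gauss_fun.
  by rewrite Rintegral_gauss_slab// mulrA.
under eq_Rintegral do rewrite inner.
rewrite RintegralZl//; last exact: continuous_integrable.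
pose k := Num.sqrt (2 * g) * s; pose m := - (Num.sqrt (2 * g) * p).
have k0 : k != 0 by rewrite mulf_neq0 ?gt_eqF.
have a1E : a1 = k * - W1 + m by rewrite /a1 /k /m; ring.
have b1E : b1 = k * W1 + m by rewrite /b1 /k /m; ring.
have NW1 : - W1 <= W1 by rewrite (le_trans _ W10)// oppr_le0.
(* The substitution x = k z + m in the outer integral. *)
have HE : \int[mu]_(x in `[a1, b1]) H x = k * \int[mu]_(z in `[- W1, W1]) H (k * z + m).
  transitivity (\int[mu]_(x in `[a1, b1]) H (1 * x + 0)).
    by apply: eq_Rintegral => x _; rewrite mul1r addr0.
  rewrite !Rintegral_affine ?oner_eq0// !mul1r !addr0 divr1 -a1E -b1E.
  by rewrite mulrC divfK.
set S := \int[mu]_(x in _) H x in HE *; move=> PhiS.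
set T := \int[mu]_(z in _) _ in HE.
rewrite (chords_integralE (c * a - b) (s * a) c W1 g0 W20).
(* After that substitution, the inner integrals over the chord and over the side of the
   rectangle agree; s^2 = 1 - c^2 identifies their end points. *)
have TE : T = \int[mu]_(z in `[- W1, W1])
  gauss_slab (Num.sqrt g * s) (- (Num.sqrt g * (c * a - b)))
          (- (Num.sqrt g * c)) (Num.sqrt g * W2 - Num.sqrt g * (s * a))
          (- (Num.sqrt g * W2) - Num.sqrt g * (s * a)) z.
  apply: eq_Rintegral => z _; rewrite /H /gauss_slab /k /m g2E.
  have arg t : (- (c * l) * (Num.sqrt 2 * Num.sqrt g * s * z + - (Num.sqrt 2 * Num.sqrt g * p)) +
      (l * (Num.sqrt 2 * Num.sqrt g * (t * s * W2 - p')) + 0)) =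
    - (Num.sqrt g * c) * z + (Num.sqrt g * (t * W2) - Num.sqrt g * (s * a)).
    rewrite /l /p /p' (_ : s * a = (1 - c ^+ 2) * a / s); first by field; rewrite !gt_eqF.
    by rewrite -s2; field; rewrite gt_eqF.
  rewrite /b2 /a2 g2E !arg mul1r mulN1r mulrN.
  congr (gauss_fun _ * _); rewrite /p; field; rewrite gt_eqF//.
rewrite -TE; move: HE PhiS; rewrite !mul1r !mulN1r addr0 => -> PhiS.
rewrite [X in _ = _ * X](_ : _ = (2 * pi * s)^-1 / l * (k * T)); last first.
  by rewrite -PhiS [(-1) ^+ _]sqrrN expr1n; ring.
have st2 : Num.sqrt 2 ^+ 2 = 2 :> R by rewrite sqr_sqrtr.
rewrite /l /k g2E -[X in _ / (X * s)]sgE -[X in (X * pi * s)^-1]st2.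
move: (pi : R) (pi_gt0 R) (Num.sqrt 2 : R) st0 (Num.sqrt g) sg0 => t1 t10 t2 t20 t3 t30.
by field; rewrite !gt_eqF.
Qed.
End chords_values.

(** * Euclidean norms and Euler matrices *)
Section euler_matrices.
Variable R : realType.

Lemma enorm_sqr m (x : 'cV[R]_m) : enorm x ^+ 2 = \sum_(i < m) x i 0 ^+ 2.
Proof. by rewrite sqr_sqrtr// sumr_ge0// => i _; exact: sqr_ge0. Qed.

Lemma enorm_sqrE m (x : 'cV[R]_m) : enorm x ^+ 2 = (x^T *m x) 0 0.
Proof.
by rewrite enorm_sqr mxE; apply: eq_bigr => i _; rewrite mxE expr2.
Qed.

Lemma enorm_orth m (Q : 'M[R]_m) (x : 'cV[R]_m) : Q^T *m Q = 1%:M ->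
  enorm (Q *m x) ^+ 2 = enorm x ^+ 2.
Proof.
by move=> QQ; rewrite !enorm_sqrE trmx_mul -mulmxA (mulmxA _ Q) QQ mul1mx.
Qed.

Lemma enorm_ge0 m (x : 'cV[R]_m) : 0 <= enorm x. Proof. exact: sqrtr_ge0. Qed.

Lemma enorm_eq0 m (x : 'cV[R]_m) : enorm x ^+ 2 = 0 -> x = 0.
Proof.
rewrite enorm_sqr => /eqP; rewrite psumr_eq0 => [/allP h|i _]; last exact: sqr_ge0.
apply/matrixP => i j; rewrite ord1 mxE; apply/eqP.
by rewrite -sqrf_eq0; apply: h; rewrite mem_index_enum.
Qed.

Lemma concatB m (x y : 'cV[R]_m) (a b : R) :
  concat x a - concat y b = concat (x - y) (a - b).
Proof.
by apply/matrixP => i j; rewrite !mxE; case: unliftP => [k|] _; rewrite ?mxE.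
Qed.

Lemma big_concat m (f : 'I_m.+1 -> R) :
  \sum_i f i = \sum_(i < m) f (lift ord_max i) + f ord_max.
Proof.
rewrite big_ord_recr/=; congr (_ + _); apply: eq_bigr => i _; congr f.
by apply/val_inj; rewrite /= /bump leqNgt ltn_ord.
Qed.

Lemma enorm_concat m (x : 'cV[R]_m) (a : R) :
  enorm (concat x a) ^+ 2 = enorm x ^+ 2 + a ^+ 2.
Proof.
rewrite !enorm_sqr big_concat; congr (_ + _).
  by apply: eq_bigr => i _; rewrite mxE liftK.
by rewrite mxE unlift_none.
Qed.

Lemma concatE m (x : 'cV[R]_m.+1) : x = concat (head_part x) (last_coord x).
Proof.
apply/matrixP => i j; rewrite ord1 mxE.
by case: unliftP => [k|] ->; rewrite ?mxE.
Qed.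

Lemma e_lastE m : e_last R m = concat 0 1.
Proof.
apply/matrixP => i j; rewrite ord1 !mxE.
case: unliftP => [k|] ->; rewrite ?mxE ?eqxx//=.
by rewrite andbT eq_sym (negbTE (neq_lift _ _)).
Qed.

Lemma extend_rotE m (Q : 'M[R]_m) (x : 'cV[R]_m) a :
  extend_rot Q *m concat x a = concat (Q *m x) a.
Proof.
apply/matrixP => i j; rewrite ord1 !mxE big_concat.
case: (unliftP ord_max i) => [k|] ->{i}; rewrite !mxE ?liftK !unlift_none.
  rewrite mul0r addr0; apply: eq_bigr => l _.
  by rewrite !mxE !liftK.
rewrite mul1r big1 ?add0r// => l _.
by rewrite !mxE !liftK unlift_none mul0r.
Qed.

Lemma plane_rotE m l (psi : R) (i j : 'I_m) : plane_rot m l psi i j =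
  if i.+1 == l then
    (if j.+1 == l then cos psi else if (j : nat) == l then sin psi else 0)
  else if (i : nat) == l then
    (if j.+1 == l then - sin psi else if (j : nat) == l then cos psi else 0)
  else ((i : nat) == j)%:R.
Proof. by rewrite mxE val_eqE. Qed.

Lemma concat_lift m (x : 'cV[R]_m) a i : concat x a (lift ord_max i) 0 = x i 0.
Proof. by rewrite mxE liftK. Qed.

Lemma concat_max m (x : 'cV[R]_m) a : concat x a ord_max 0 = a.
Proof. by rewrite mxE unlift_none. Qed.

Lemma lift_maxE m (i : 'I_m) : lift ord_max i = i :> nat.
Proof. by rewrite /= /bump leqNgt ltn_ord. Qed.

Ltac eqn_cases := simpl; repeat (case: eqP => ? /=; try lia).

Lemma plane_rot_last m (psi : R) (x : 'cV[R]_m) a b :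
  plane_rot m.+2 m.+1 psi *m concat (concat x a) b =
  concat (concat x (cos psi * a + sin psi * b)) (- sin psi * a + cos psi * b).
Proof.
apply/matrixP => i j; rewrite ord1 mxE !big_concat {j}.
rewrite !(concat_lift, concat_max) !plane_rotE !lift_maxE.
under eq_bigr => l _ do rewrite !concat_lift plane_rotE !lift_maxE.
case: (unliftP ord_max i) => [i'|] ->{i}; last first.
  rewrite concat_max; congr (_ + _ * b); last by eqn_cases.
  rewrite big1 => [|l _].
    by rewrite add0r; congr (_ * a); eqn_cases.
  by have := ltn_ord l; eqn_cases; rewrite mul0r.
rewrite concat_lift !lift_maxE.
case: (unliftP ord_max i') => [i|] ->{i'}; last first.
  rewrite concat_max; congr (_ + _ * b); last by eqn_cases.
  rewrite big1 => [|l _].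
    by rewrite add0r; congr (_ * a); eqn_cases.
  by have := ltn_ord l; eqn_cases; rewrite mul0r.
rewrite concat_lift !lift_maxE; have := ltn_ord i; rewrite /= => im.
rewrite [X in _ + X * a + _](_ : _ = 0); last by move: im; eqn_cases.
rewrite [X in _ + X * b](_ : _ = 0); last by move: im; eqn_cases.
rewrite !mul0r !addr0 (bigD1 i)//= big1 => [|l li].
  by rewrite addr0 -[RHS]mul1r; congr (_ * _); move: im; eqn_cases.
by have := ltn_ord l; move: im li; rewrite -val_eqE /=; eqn_cases; rewrite ?mul0r.
Qed.

(** A rotation of two of the first [m.+1] coordinates does not see the last one. *)
Lemma plane_rot_extend m l (psi : R) (x : 'cV[R]_m.+1) a : (0 < l <= m)%N ->
  plane_rot m.+2 l psi *m concat x a = concat (plane_rot m.+1 l psi *m x) a.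
Proof.
move=> /andP[l0 lm].
apply/matrixP => i j; rewrite ord1 mxE big_concat {j} concat_max.
case: (unliftP ord_max i) => [i'|] ->{i}.
  rewrite concat_lift [RHS]mxE [X in _ + X * _](_ : _ = 0).
    rewrite mul0r addr0; apply: eq_bigr => k _.
    by rewrite concat_lift !plane_rotE !lift_maxE.
  by rewrite plane_rotE !lift_maxE/=; have := ltn_ord i'; eqn_cases.
rewrite concat_max big1 ?add0r => [|k _].
  by rewrite plane_rotE /= -[RHS]mul1r; congr (_ * _); eqn_cases.
rewrite plane_rotE lift_maxE /=; have := ltn_ord k; eqn_cases; rewrite ?mul0r//.
Qed.

(** The Euler matrix is the rotation of the last two coordinates applied after
    the Euler matrix of the preceding dimension. *)
Lemma euler_mx_concat m (phi : nat -> R) (x : 'cV[R]_m.+1) b :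
  let y := euler_mx m.+1 phi *m x in
  let c := cos (phi m.+1) in let s := sin (phi m.+1) in
  euler_mx m.+2 phi *m concat x b =
  concat (concat (head_part y) (c * last_coord y - s * b))
         (s * last_coord y + c * b).
Proof.
move=> y c s; have iotaE : rev (iota 1 m.+1) = m.+1 :: rev (iota 1 m).
  by rewrite -[in LHS](addn1 m) iotaD rev_cat add1n.
rewrite /euler_mx [m.+2.-1]/= iotaE big_cons.
rewrite -mulmxA.
suff -> : \big[mulmx/1%:M]_(l <- rev (iota 1 m)) plane_rot m.+2 l (- phi l) *m concat x b
    = concat y b.
  by rewrite [y]concatE plane_rot_last cosN sinN opprK mulNr -concatE.
rewrite /y /euler_mx [m.+1.-1]/=.
have : all (fun l => 0 < l <= m)%N (rev (iota 1 m)).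
  by apply/allP => l; rewrite mem_rev mem_iota add1n ltnS.
elim: (rev _) => [_|l r IH /= /andP[hl hr]]; first by rewrite !big_nil !mul1mx.
by rewrite !big_cons -!mulmxA IH// plane_rot_extend.
Qed.
End euler_matrices.

(** * Distance between points of two chords *)
Section geometry.
Local Open Scope classical_set_scope.
Local Open Scope ring_scope.
Variable R : realType.

Lemma enormN m (x : 'cV[R]_m) : enorm (- x) = enorm x.
Proof. by congr Num.sqrt; apply: eq_bigr => i _; rewrite mxE sqrrN. Qed.

Lemma enorm_extend_rot m (Q : 'M[R]_m) (x : 'cV[R]_m.+1) : Q^T *m Q = 1%:M ->
  enorm (extend_rot Q *m x) ^+ 2 = enorm x ^+ 2.
Proof.
by move=> QQ; rewrite (concatE x) extend_rotE !enorm_concat enorm_orth.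
Qed.

(** Applying [R2] puts the second chord parallel to the last axis and the first
    one at the relative angle; undoing [Rt] on the first coordinates leaves only
    the rotation of the last two coordinates, in which the parameters occur. *)
Lemma chord_points_distance n (R1 R2 : 'M[R]_n.+2) (Rt : 'M[R]_n.+1)
    (phi : nat -> R) (x1 x2 : 'cV[R]_n.+1) (z1 z2 : R) :
  R2^T *m R2 = 1%:M -> Rt^T *m Rt = 1%:M ->
  R2 *m R1^T = extend_rot Rt *m euler_mx n.+2 phi ->
  let y1 := euler_mx n.+1 phi *m x1 in
  let y2 := Rt^T *m x2 in
  let c := cos (phi n.+1) in let s := sin (phi n.+1) in
  enorm (R2^T *m concat x2 z2 - R1^T *m concat x1 z1) ^+ 2 =
  enorm (head_part y1 - head_part y2) ^+ 2 +
  ((c * last_coord y1 - last_coord y2 - s * z1) ^+ 2 +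
   (s * last_coord y1 + c * z1 - z2) ^+ 2).
Proof.
move=> RR2 RRt E y1 y2 c s.
rewrite -enormN opprB -(enorm_orth _ RR2) mulmxBr !mulmxA E (mulmx1C RR2) mul1mx.
have -> : concat x2 z2 = extend_rot Rt *m concat y2 z2.
  by rewrite extend_rotE /y2 mulmxA (mulmx1C RRt) mul1mx.
rewrite -mulmxA -mulmxBr enorm_extend_rot// euler_mx_concat -/y1 -/c -/s.
rewrite [in concat y2 z2](concatE y2) !concatB !enorm_concat -addrA.
by congr (_ + (_ + _)); congr (_ ^+ 2); ring.
Qed.

Lemma relative_cosine n (Rt : 'M[R]_n.+1) (phi : nat -> R) :
  ((e_last R n.+1)^T *m (extend_rot Rt *m euler_mx n.+2 phi) *m e_last R n.+1) 0 0
  = cos (phi n.+1).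
Proof.
rewrite -mulmxA trmx_delta -rowE mxE -mulmxA e_lastE euler_mx_concat mulmx0.
by rewrite extend_rotE concat_max /last_coord mxE mulr0 mulr1 add0r.
Qed.

Lemma enormB_sqr m (u v : 'cV[R]_m) :
  enorm (u - v) ^+ 2 = enorm u ^+ 2 + enorm v ^+ 2 - 2 * (v^T *m u) 0 0.
Proof.
rewrite !enorm_sqr mxE mulr_sumr -big_split -sumrB; apply: eq_bigr => i _.
by rewrite !mxE /=; ring.
Qed.

(** The axes are unit vectors [u] and [v] with inner product [r], hence
    [|u - v|^2 = 2 - 2 r] and [|u + v|^2 = 2 + 2 r]. *)
Lemma same_axisP m (R1 R2 : 'M[R]_m.+1) :
  R1^T *m R1 = 1%:M -> R2^T *m R2 = 1%:M ->
  let r := ((e_last R m)^T *m (R2 *m R1^T) *m e_last R m) 0 0 in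
  same_axis R1 R2 <-> `|r| = 1.
Proof.
move=> RR1 RR2 r.
set u := R1^T *m e_last R m; set v := R2^T *m e_last R m.
have e1 : enorm (e_last R m) ^+ 2 = 1.
  rewrite e_lastE enorm_concat enorm_sqr big1 ?add0r ?expr1n// => i _.
  by rewrite mxE expr0n.
have u1 : enorm u ^+ 2 = 1.
  by rewrite enorm_orth// trmxK; exact: mulmx1C.
have v1 : enorm v ^+ 2 = 1.
  by rewrite enorm_orth// trmxK; exact: mulmx1C.
have rE : r = (v^T *m u) 0 0 by rewrite /r /v /u trmx_mul trmxK !mulmxA.
have nB : enorm (u - v) ^+ 2 = 2 - 2 * r by rewrite enormB_sqr u1 v1 rE.
have nD : enorm (u + v) ^+ 2 = 2 + 2 * r.
  rewrite -[v]opprK enormB_sqr enormN u1 v1 rE.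
  by rewrite linearN /= mulNmx mxE; ring.
rewrite /same_axis -/u -/v; split.
  case=> uv.
    move: nB; rewrite uv subrr enorm_sqr big1 => [r1|i _]; last by rewrite mxE expr0n.
    by rewrite (_ : r = 1) ?normr1//; lra.
  move: nD; rewrite uv addNr enorm_sqr big1 => [r1|i _]; last by rewrite mxE expr0n.
  by rewrite (_ : r = -1) ?normrN1//; lra.
move=> /eqP; rewrite eqr_norml ler01 andbT => /orP[]/eqP r1.
  by left; apply/eqP; rewrite -subr_eq0; apply/eqP/enorm_eq0; rewrite nB r1; ring.
by right; apply/eqP; rewrite -addr_eq0; apply/eqP/enorm_eq0; rewrite nD r1; ring.
Qed.

Lemma eval_ball_in m (f : unit_ball R m -> R) y (h : enorm y <= 1) :
  eval_ball f y = f (Sub y h).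
Proof. by rewrite /eval_ball insubT. Qed.

Lemma W_fun_ge0 m (x : 'cV[R]_m) : 0 <= W_fun x. Proof. exact: sqrtr_ge0. Qed.

Lemma chord_ball m (Q : 'M[R]_m.+1) (x : unit_ball R m) (z : R) : Q^T *m Q = 1%:M ->
  chord (\val x) z -> enorm (Q^T *m concat (\val x) z) <= 1.
Proof.
move=> QQ; rewrite /chord /= in_itv /= -ler_norml => zW.
rewrite -(@expr_le1 _ 2)// ?enorm_ge0//.
rewrite enorm_orth ?trmxK; last exact: mulmx1C.
rewrite enorm_concat -[z ^+ 2]real_normK ?num_real//.
have x1 : enorm (\val x) ^+ 2 <= 1 by rewrite expr_le1// ?enorm_ge0//; exact: (valP x).
have : `|z| ^+ 2 <= W_fun (\val x) ^+ 2 by rewrite ler_sqr ?nnegrE// ?W_fun_ge0.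
rewrite [X in _ <= X -> _]sqr_sqrtr; lra.
Qed.
End geometry.

(** * The composition as an iterated integral *)
Section adjoint.
Variable R : realType.

(** The value at [u] is the inner product with the kernel section at [u], which the
    adjoint relation moves to the second space, where the reproducing property
    evaluates at [x]. *)
Lemma adjoint_kernel (T1 T2 : Type) (K1 : T1 -> T1 -> R) (K2 : T2 -> T2 -> R)
    (H1 : rkhs K1) (H2 : rkhs K2) (A : (T1 -> R) -> (T2 -> R))
    (B : (T2 -> R) -> (T1 -> R)) :
  bounded_operator H1 H2 A -> is_adjoint H1 H2 A B ->
  forall x u, B (K2 ^~ x) u = A (K1 ^~ u) x.
Proof.
move=> [Amap _ _] [Bmap BE] x u.
have kx := rkhs_kernel H2 x; have ku := rkhs_kernel H1 u.
rewrite -(rkhs_reproducing u (Bmap _ kx)) rkhs_ip_sym//; last exact: Bmap.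
by rewrite -BE// rkhs_reproducing//; exact: Amap.
Qed.
End adjoint.

Section composition.
Local Open Scope classical_set_scope.
Local Open Scope ring_scope.
Variable R : realType.
Notation mu := (@lebesgue_measure R).

Lemma Rintegral_chords (g d p q c s W1 W2 : R) : 0 < g -> 0 <= W1 -> 0 <= W2 ->
  \int[mu]_(z1 in `[- W1, W1]) \int[mu]_(z2 in `[- W2, W2])
    expR (- g * (d + ((p - s * z1) ^+ 2 + (q + c * z1 - z2) ^+ 2))) =
  expR (- g * d) * chords_integral g p q c s W1 W2.
Proof.
move=> g0 W10 W20; rewrite /chords_integral.
rewrite -RintegralZl//; last first.
  by apply: continuous_integrable; exact: continuous_chords_integral_inner.
apply: eq_Rintegral => z1 _; rewrite -RintegralZl//; last first.
  by apply: continuous_integrable; exact: continuous_chords_gauss.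
by apply: eq_Rintegral => z2 _; rewrite /chords_gauss -expRD mulrDr.
Qed.

Lemma Xray_adjoint_gaussian n (g : R) (R1 R2 Q : 'M[R]_n.+2)
    (x1 x2 : unit_ball R n.+1)
    (HK : rkhs (@gaussian_kernel R n.+2 g))
    (HKt : rkhs (induced_kernel Q (@gaussian_kernel R n.+2 g)))
    (Pstar : (unit_ball R n.+1 -> R) -> (unit_ball R n.+2 -> R)) :
  R1^T *m R1 = 1%:M -> R2^T *m R2 = 1%:M ->
  bounded_operator HK HKt (Xray R2) -> is_adjoint HK HKt (Xray R2) Pstar ->
  Xray R1 (Pstar (induced_kernel Q (@gaussian_kernel R n.+2 g) ^~ x2)) x1 =
  \int[mu]_(z1 in chord (\val x1)) \int[mu]_(z2 in chord (\val x2))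
    expR (- g * enorm (R2^T *m concat (\val x2) z2 - R1^T *m concat (\val x1) z1) ^+ 2).
Proof.
move=> RR1 RR2 hP hPs; apply: eq_Rintegral => z1 /set_mem z1W.
rewrite (eval_ball_in _ (chord_ball RR1 z1W)) (adjoint_kernel hP hPs).
apply: eq_Rintegral => z2 /set_mem z2W.
by rewrite (eval_ball_in _ (chord_ball RR2 z2W)).
Qed.
End composition.

Theorem propositionA3 (R : realType) (n : nat) (gamma : R) (hgamma : 0 < gamma)
    (R1 R2 : 'M[R]_n.+2) (hR1 : SO R1) (hR2 : SO R2)
    (x1 x2 : unit_ball R n.+1)
    (* the reproducing kernel Hilbert spaces of K and of the induced kernel *)
    (Q : 'M[R]_n.+2) (hQ : SO Q)
    (HK : rkhs (@gaussian_kernel R n.+2 gamma))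
    (HKt : rkhs (induced_kernel Q (@gaussian_kernel R n.+2 gamma)))
    (* Pstar is the adjoint of the bounded operator P_{R2} *)
    (Pstar : (unit_ball R n.+1 -> R) -> (unit_ball R n.+2 -> R))
    (hP : bounded_operator HK HKt (Xray R2))
    (hPstar : is_adjoint HK HKt (Xray R2) Pstar)
    (* phi: the chosen spherical coordinates of the axis of R2 R1^T *)
    (phi : nat -> R)
    (hphi : sph_coords ((R2 *m R1^T)^T *m e_last R n.+1) phi)
    (Rt : 'M[R]_n.+1) (hRt : SO Rt)
    (hRtE : R2 *m R1^T = extend_rot Rt *m euler_mx n.+2 phi) :
  let r := ((e_last R n.+1)^T *m (R2 *m R1^T) *m e_last R n.+1) 0 0 in
  let y1 := euler_mx n.+1 phi *m \val x1 in
  let y2 := Rt^T *m \val x2 in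
  let xt1 := head_part y1 in
  let xr1 := last_coord y1 in
  let xt2 := head_part y2 in
  let xR2 := last_coord y2 in
  let mu1 := r * xr1 - xR2 in
  let mu2 := xr1 - r * xR2 in
  let ktx2 := fun x => induced_kernel Q (@gaussian_kernel R n.+2 gamma) x x2 in
  let W1 := W_fun (\val x1) in
  let W2 := W_fun (\val x2) in
  ((same_axis R1 R2 <-> `|r| = 1) /\
   (same_axis R1 R2 ->
    Xray R1 (Pstar ktx2) x1 =
      expR (- gamma * enorm (concat xt1 (r * xr1) - Rt^T *m \val x2) ^+ 2)
      / (2 * gamma) *
      \sum_(i < 2) \sum_(j < 2) (-1) ^+ (i + j) *
        Phi (Num.sqrt gamma * ((-1) ^+ i * W1 + (-1) ^+ j * W2)))) /\
  ((~ same_axis R1 R2 <-> `|r| < 1) /\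
   (~ same_axis R1 R2 ->
    Xray R1 (Pstar ktx2) x1 =
      pi * expR (- gamma * enorm (xt1 - xt2) ^+ 2) / (gamma * w_fun r) *
      \sum_(i < 2) \sum_(j < 2) (-1) ^+ (i + j) *
        Phi2 r (Num.sqrt (2 * gamma) * ((-1) ^+ i * w_fun r * W1 - mu1))
               (Num.sqrt (2 * gamma) * ((-1) ^+ j * w_fun r * W2 - mu2)))).
Proof.
move=> r y1 y2 xt1 xr1 xt2 xR2 mu1 mu2 ktx2 W1 W2.
case: hR1 hR2 hRt => RR1 _ [RR2 _] [RRt _].
pose s := sin (phi n.+1).
have rE : r = cos (phi n.+1) by rewrite /r hRtE relative_cosine.
have rs : r ^+ 2 + s ^+ 2 = 1 by rewrite rE cos2Dsin2.
have W10 : 0 <= W1 by exact: W_fun_ge0.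
have W20 : 0 <= W2 by exact: W_fun_ge0.
have axisP : same_axis R1 R2 <-> `|r| = 1 by exact: same_axisP.
have r1 : `|r| <= 1.
  by rewrite -(@expr_le1 _ 2)// real_normK ?num_real//; have := sqr_ge0 s; lra.
have XE : Xray R1 (Pstar ktx2) x1 =
    expR (- gamma * enorm (xt1 - xt2) ^+ 2) * chords_integral gamma mu1 (s * xr1) r s W1 W2.
  rewrite -Rintegral_chords// (Xray_adjoint_gaussian _ _ RR1 RR2 hP hPstar).
  apply: eq_Rintegral => z1 _; apply: eq_Rintegral => z2 _.
  by rewrite (chord_points_distance _ _ _ _ RR2 RRt hRtE) -rE.
have naxisP : ~ same_axis R1 R2 <-> `|r| < 1.
  rewrite axisP lt_neqAle r1 andbT; split; first by move/eqP.
  by move=> /eqP.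
split; [split=> [//|/axisP r_1]|split=> [//|/naxisP r_1]].
- have s0 : s = 0.
    apply/eqP; rewrite -sqrf_eq0; apply/eqP.
    by move: rs; rewrite -[r ^+ 2]real_normK ?num_real// r_1 expr1n; lra.
  have r_pm : r = 1 \/ r = -1.
    by move/eqP: r_1; rewrite eqr_norml ler01 andbT => /orP[]/eqP; [left|right].
  rewrite XE s0 mul0r chords_integral_parallel// mulrA mulrA -expRD -mulrDr.
  by rewrite -/y2 [in RHS](concatE y2) concatB enorm_concat.
- have s0 : s != 0.
    apply: contraTneq r_1 => s0; rewrite -leNgt.
    by rewrite -(@expr_ge1 _ 2)// real_normK ?num_real// -rs s0 expr0n addr0.
  have wE : w_fun r = `|s| by rewrite /w_fun -rs addrC addKr sqrtr_sqr.
  have w0 : 0 < w_fun r by rewrite wE normr_gt0.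
  have flipE : chords_integral gamma mu1 (s * xr1) r s W1 W2 =
      chords_integral gamma mu1 (w_fun r * xr1) r (w_fun r) W1 W2.
    rewrite wE; have [sp|sn] := ltP 0 s; first by rewrite gtr0_norm.
    rewrite (ler0_norm sn) mulNr; apply/esym.
    exact: (@chords_integral_flip R gamma mu1 (s * xr1) r s W1 W2).
  rewrite XE flipE (@chords_integral_transverse R gamma xr1 xR2 r (w_fun r)
    W1 W2 hgamma W10 W20 w0 r_1 erefl).
  rewrite mulrA; congr (_ * _).
  by rewrite mulrCA mulrA.
Qed.
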